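(* Assume $\operatorname{epi}(z)\neq\emptyset$, let $(x^*,\eta^* )\in(\mathbb{R}^n\times\mathbb{R})\setminus\operatorname{epi}(z)$, and let $(\omega,\omega_0)\in\operatorname{cl}(\operatorname{pos}(\operatorname{epi}(z)-(x^*,\eta^* )))$. Then there exists an optimal vertex $(\gamma^*,\gamma_0^* )\in P^{\le}(x^*,\eta^* )$ with respect to the objective function $(H\omega,-\omega_0)$ (i.e. a vertex of $P^{\le}(x^*,\eta^* )$ maximizing $(H\omega)^\top\gamma-\omega_0\gamma_0$ over $(\gamma,\gamma_0)\in P^{\le}(x^*,\eta^* )$) such that the resulting cut normal $(H^\top\gamma^*,-\gamma_0^* )$ is $(x^*,\eta^* )$-separating (i.e. is the normal vector of an $(x^*,\eta^* )$-separating halfspace for $\operatorname{epi}(z)$) and satisfies the Facet criterion.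
   Context: Let $H \in \mathbb{R}^{m\times n}$, $A\in\mathbb{R}^{m\times k}$, $b\in\mathbb{R}^m$, $d\in\mathbb{R}^k$. Define $z(x) := \min_{y\in\mathbb{R}^k}\{d^\top y : Ay \le b-Hx\}$ for $x\in\mathbb{R}^n$, with epigraph $$\operatorname{epi}(z) = \{(x,\eta)\in\mathbb{R}^n\times\mathbb{R} : \exists y\in\mathbb{R}^k:\ Ay\le b-Hx,\ d^\top y\le\eta\}.$$ The relaxed alternative polyhedron is $$P^{\le}(x^*,\eta^* ) := \{(\gamma,\gamma_0)\in\mathbb{R}^m\times\mathbb{R} : \gamma,\gamma_0\ge 0,\ \gamma^\top A+\gamma_0 d^\top=0,\ \gamma^\top(b-Hx^* )+\gamma_0\eta^*\le-1\}.$$ $\operatorname{pos}(C)$ denotes the conic hull of $C$ (nonnegative combinations) and $\operatorname{cl}$ the closure. For $p\in\mathbb{R}^N$, $\alpha\in\mathbb{R}$, let $H^{\le}_{(p,\alpha)}=\{u : p^\top u\le\alpha\}$ and $H_{(p,\alpha)}=\{u : p^\top u=\alpha\}$. For a convex set $C\subset\mathbb{R}^N$ and a point $u\notin C$, the halfspace $H^{\le}_{(p,\alpha)}$ is $u$-separating for $C$ if it contains $C$ but not $u$. The halfspace $H^{\le}_{(p,\alpha)}$ is facet-defining for $C$ if $C\subseteq H^{\le}_{(p,\alpha)}$ and $H_{(p,\alpha)}\cap C$ contains $\dim(C)$ many affinely independent points. Facet criterion: a vector $(\pi,\pi_0)\in(\mathbb{R}^n\times\mathbb{R})\setminus\{0\}$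 satisfies the Facet criterion if there exists $\alpha\in\mathbb{R}$ such that $H^{\le}_{((\pi,\pi_0),\alpha)}$ is either facet-defining for $\operatorname{epi}(z)$ or the corresponding hyperplane $H_{((\pi,\pi_0),\alpha)}$ contains $\operatorname{epi}(z)$. *)

(* Defs.v *)
From HB Require Import structures.
From mathcomp Require Import all_boot all_order all_algebra.
From mathcomp Require Import all_classical all_reals all_analysis.
Import Order.TTheory GRing.Theory Num.Theory numFieldNormedType.Exports.

Set Implicit Arguments.
Unset Strict Implicit.
Unset Printing Implicit Defensive.

Local Open Scope classical_set_scope.
Local Open Scope ring_scope.

Definition conic_hull (R : realType) (V : vectType R) (C : set V) : set V :=
  [set u | exists (k : nat) (c : 'I_k -> V) (a : 'I_k -> R),
    [/\ forall i, C (c i), forall i, 0 <= a i & u = \sum_i a i *: c i]].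

Definition affine_hull (R : realType) (V : vectType R) (C : set V) : set V :=
  [set u | exists (k : nat) (c : 'I_k -> V) (a : 'I_k -> R),
    [/\ forall i, C (c i), \sum_i a i = 1 & u = \sum_i a i *: c i]].

(* [affine_dim C d] : the affine hull of [C] is a translate of a
   [d]-dimensional linear subspace.  No [d] qualifies when [C] is empty. *)
Definition affine_dim (R : realType) (V : vectType R) (C : set V) (d : nat) :
    Prop :=
  exists (c : V) (W : {vspace V}),
    affine_hull C = [set c + w | w in [set w : V | w \in W]] /\ \dim W = d.

Definition affinely_independent (R : realType) (V : vectType R) (k : nat)
    (c : 'I_k -> V) : Prop :=
  forall a : 'I_k -> R,
    \sum_i a i = 0 -> \sum_i a i *: c i = 0 -> forall i, a i = 0.

Definition extreme_point (R : realType) (V : vectType R) (P : set V) (v : V) :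
    Prop :=
  P v /\ forall (u w : V) (t : R), P u -> P w -> 0 < t < 1 ->
    v = t *: u + (1 - t) *: w -> u = w.

Definition dotp (R : realType) (n : nat) (p u : 'cV[R]_n * R) : R :=
  (p.1^T *m u.1) 0 0 + p.2 * u.2.

Definition halfspace (R : realType) (n : nat) (p : 'cV[R]_n * R) (alpha : R) :
    set ('cV[R]_n * R) :=
  [set u | dotp p u <= alpha].

Definition hyperplane (R : realType) (n : nat) (p : 'cV[R]_n * R) (alpha : R) :
    set ('cV[R]_n * R) :=
  [set u | dotp p u = alpha].

Definition separating (R : realType) (n : nat) (C : set ('cV[R]_n * R))
    (u p : 'cV[R]_n * R) (alpha : R) : Prop :=
  C `<=` halfspace p alpha /\ ~ halfspace p alpha u.

Definition facet_defining (R : realType) (n : nat) (C : set ('cV[R]_n * R))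
    (p : 'cV[R]_n * R) (alpha : R) : Prop :=
  C `<=` halfspace p alpha /\
  exists d : nat, affine_dim C d /\
    exists c : 'I_d -> 'cV[R]_n * R,
      affinely_independent c /\ forall i, (hyperplane p alpha `&` C) (c i).

(* The epigraph of z(x) = min {d^T y : A y <= b - H x}. *)
Definition epi_z (R : realType) (m n k : nat) (H : 'M[R]_(m, n))
    (A : 'M[R]_(m, k)) (b : 'cV[R]_m) (d : 'cV[R]_k) : set ('cV[R]_n * R) :=
  [set u : 'cV[R]_n * R | exists y : 'cV[R]_k,
    (forall i, (A *m y) i 0 <= (b - H *m u.1) i 0) /\
    (d^T *m y) 0 0 <= u.2].

Definition relaxed_alt_polyhedron (R : realType) (m n k : nat)
    (H : 'M[R]_(m, n)) (A : 'M[R]_(m, k)) (b : 'cV[R]_m) (d : 'cV[R]_k)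
    (xs : 'cV[R]_n) (etas : R) : set ('cV[R]_m * R) :=
  [set g : 'cV[R]_m * R | [/\ forall i, 0 <= g.1 i 0, 0 <= g.2,
    g.1^T *m A + g.2 *: d^T = 0 &
    (g.1^T *m (b - H *m xs)) 0 0 + g.2 * etas <= -1]].

Definition facet_criterion (R : realType) (m n k : nat) (H : 'M[R]_(m, n))
    (A : 'M[R]_(m, k)) (b : 'cV[R]_m) (d : 'cV[R]_k) (p : 'cV[R]_n * R) :
    Prop :=
  p <> 0 /\ exists alpha : R,
    facet_defining (epi_z H A b d) p alpha \/
    epi_z H A b d `<=` hyperplane p alpha.

(* Main.v *)
(* By Farkas' lemma the alternative polyhedron P is nonempty, and its points
   (gamma, gamma0) give exactly the normals pi = (H^T gamma, -gamma0), up to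
   weakening, with pi.(u - z) <= -1 on the epigraph, where z = (xs, etas).
   Maximize over P, lexicographically, first pi.omega, then pi.(u_j - z) for
   finitely many u_j in the epigraph such that the u_j - z span all u - z, and
   finally the negated coordinates.  All these objectives are bounded above, so
   the maximum is attained; the coordinates make it a single point g, hence a
   vertex.  Let T be the face of the epigraph tight for g.  If the t - z with t
   in T did not span all u - z, some nonzero functional p on that span would
   vanish on T - z; Farkas' lemma then moves g within P so that pi changes by a
   positive multiple of p, and likewise of -p, contradicting the lexicographic
   maximality of the pi.(u_j - z).  So T - z contains a basis of the span of
   epi - z.  If z lies in the affine hull of the epigraph, this basis gives
   dim(epi) affinely independent points of T; otherwise T affinely spans the
   epigraph, and the hyperplane contains it. *)
Require Import Defs.
From HB Require Import structures.
From mathcomp Require Import all_boot all_order all_algebra.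
From mathcomp Require Import all_classical all_reals all_analysis.
From mathcomp Require Import ring lra.
Import Order.TTheory GRing.Theory Num.Theory numFieldNormedType.Exports.

Set Implicit Arguments.
Unset Strict Implicit.
Unset Printing Implicit Defensive.

Local Open Scope classical_set_scope.
Local Open Scope ring_scope.

(** * Farkas' lemma for finitely many linear functionals *)

Section Farkas.
Variables (R : realFieldType) (V : lmodType R).
Implicit Types (f g c : V -> R) (v w : V).

Lemma scalarD f (fP : scalar f) v w : f (v + w) = f v + f w.
Proof. by have := fP 1 v w; rewrite scale1r mul1r. Qed.

Lemma scalar0 f (fP : scalar f) : f 0 = 0.
Proof. by apply: (addrI (f 0)); rewrite -scalarD // !addr0. Qed.

Lemma scalarZ f (fP : scalar f) a v : f (a *: v) = a * f v.
Proof. by have := fP a v 0; rewrite !addr0 scalar0 // addr0. Qed.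

Lemma scalarN f (fP : scalar f) v : f (- v) = - f v.
Proof. by rewrite -scaleN1r scalarZ // mulN1r. Qed.

Lemma scalarB f (fP : scalar f) v w : f (v - w) = f v - f w.
Proof. by rewrite scalarD // scalarN. Qed.

Lemma scalar_sum f (fP : scalar f) k (a : 'I_k -> R) (v : 'I_k -> V) :
  f (\sum_i a i *: v i) = \sum_i a i * f (v i).
Proof.
elim/big_rec2: _ => [|i x y _ <-]; first exact: scalar0.
by rewrite scalarD // scalarZ.
Qed.

Lemma scalar_opp f (fP : scalar f) : scalar (fun v => - f v).
Proof. by move=> a v w; rewrite fP; ring. Qed.

(* Bartl's induction: a point [v0] witnessing that the last inequality is
   needed projects the system along [v0] onto the kernel of that inequality. *)
Lemma farkas_seq (I : eqType) (s : seq I) (a : I -> V -> R) c :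
  uniq s -> (forall i, scalar (a i)) -> scalar c ->
  (forall v, (forall i, i \in s -> a i v <= 0) -> c v <= 0) ->
  exists2 l : I -> R, forall i, 0 <= l i &
    forall v, c v = \sum_(i <- s) l i * a i v.
Proof.
move=> + + + H; elim: s a c H => [|j s IH] a c H /= uniq_s aP cP.
  exists (fun=> 0) => // v; rewrite big_nil.
  apply/eqP; rewrite eq_le H //= -oppr_le0 -scalarN //; exact: H.
move: uniq_s => /andP[js uniq_s].
have extend l l0 : (forall i, 0 <= l i) -> 0 <= l0 ->
    (forall v, c v = \sum_(i <- s) l i * a i v + l0 * a j v) ->
    exists2 l : I -> R, forall i, 0 <= l i &
      forall v, c v = \sum_(i <- j :: s) l i * a i v.
  move=> l_ge0 l0_ge0 cE; exists (fun i => if i == j then l0 else l i).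
    by move=> i; case: ifP.
  move=> v; rewrite cE big_cons eqxx addrC; congr (_ + _).
  apply: eq_big_seq => i is_s; case: eqP => // ij.
  by rewrite -ij is_s in js.
have [Hs|/existsNP[v0 /not_implyP[v0s /negP]]] :=
    pselect (forall v, (forall i, i \in s -> a i v <= 0) -> c v <= 0).
  have [l l_ge0 cE] := IH a c Hs uniq_s aP cP.
  by apply: (extend l 0) => // v; rewrite mul0r addr0.
rewrite -ltNge => cv0.
have av0 : 0 < a j v0.
  rewrite ltNge; apply/negP => av0; move: cv0; rewrite ltNge H // => i.
  by rewrite inE => /orP[/eqP ->|]; [|exact: v0s].
(* [r f] is [f] composed with the projection along [v0] onto the kernel of [a j]. *)
pose r f v := f v - f v0 / a j v0 * a j v.
have rE f v : scalar f -> r f v = f (v - (a j v / a j v0) *: v0).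
  by move=> fP; rewrite scalarB // scalarZ // /r; ring.
have rP f : scalar f -> scalar (r f).
  by move=> fP t v w; rewrite /r fP (aP j t v w); ring.
have [||//||l l_ge0 rcE] := IH (fun i => r (a i)) (r c) => //; last first.
(* Comparing both sides at [v0] forces this weight; it is nonnegative since [c v0 > 0] and
   [a i v0 <= 0] on [s]. *)
- pose l0 := (c v0 - \sum_(i <- s) l i * a i v0) / a j v0.
  apply: (extend l l0) => //.
    apply: divr_ge0; last exact: ltW.
    rewrite subr_ge0 (le_trans _ (ltW cv0)) //.
    rewrite big_seq sumr_le0 // => i is_s.
    by rewrite mulr_ge0_le0 // v0s.
  move=> v; have := rcE v; rewrite /r => /eqP; rewrite subr_eq => /eqP ->.
  rewrite (eq_bigr (fun i => l i * a i v - l i * a i v0 * (a j v / a j v0))).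
    by rewrite sumrB -mulr_suml /l0; ring.
  by move=> i _; ring.
- exact: rP.
- by move=> i; exact: rP.
- move=> v Hv; rewrite rE //; apply: H => i; rewrite inE => /orP[/eqP ->|].
    by rewrite scalarB // scalarZ // divfK ?subrr // gt_eqF.
  by move=> /Hv; rewrite rE.
Qed.

Lemma farkas (I : finType) (a : I -> V -> R) c :
  (forall i, scalar (a i)) -> scalar c ->
  (forall v, (forall i, a i v <= 0) -> c v <= 0) ->
  exists2 l : I -> R, forall i, 0 <= l i & forall v, c v = \sum_i l i * a i v.
Proof.
move=> aP cP H; apply: farkas_seq => //; first exact: index_enum_uniq.
by move=> v Hv; apply: H => i; apply: Hv; rewrite mem_index_enum.
Qed.

End Farkas.

(** * Maxima over polyhedra, single and lexicographic *)

Section LexMax.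
Variables (R : realType) (V : lmodType R).
Implicit Types (P : set V) (v w : V).

Definition polyhedral P := exists (I : finType) (f : I -> V -> R) (q : I -> R),
  (forall i, scalar (f i)) /\ P = [set v | forall i, f i v <= q i].

Lemma polyhedral_ge P (c : V -> R) (r : R) :
  scalar c -> polyhedral P -> polyhedral (P `&` [set v | r <= c v]).
Proof.
move=> cP [I [f [q [fP ->]]]].
exists (option I), (fun i => if i is Some i then f i else fun v => - c v),
  (fun i => if i is Some i then q i else - r); split.
  by move=> [i|]; [exact: fP|exact: scalar_opp].
apply/seteqP; split => v /= => [[Pv cv] [i|]|H] //; first by rewrite lerN2.
by split=> [i|]; [exact: (H (Some i))|rewrite -lerN2; exact: (H None)].
Qed.

(** If the supremum [s] were not attained, the homogenized system with [s t <= c v] would force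
    [t <= 0]; the Farkas weights then bound [c] on [P] by [s - 1/mu], below the supremum. *)
Lemma polyhedral_max P (c : V -> R) (M : R) :
  scalar c -> polyhedral P -> P !=set0 -> (forall v, P v -> c v <= M) ->
  exists2 v, P v & forall w, P w -> c w <= c v.
Proof.
move=> cP [I [f [q [fP ->]]]] [v0 Pv0] cM; set P' := [set v | _] in Pv0 cM *.
pose E := [set c v | v in P']; pose s := sup E.
have supE : has_sup E.
  by split; [exists (c v0), v0|exists M => _ [v Pv <-]; exact: cM].
have le_s v : P' v -> c v <= s by move=> Pv; apply: sup_upper_bound => //; exists v.
apply: contrapT => nmax.
have lt_s v : P' v -> c v < s.
  move=> Pv; rewrite lt_neqAle le_s // andbT; apply/negP => /eqP cvs.
  by apply: nmax; exists v => // w /le_s; rewrite cvs.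
pose a (i : I + bool) (u : V * R^o) : R := match i with
  | inl i => f i u.1 - q i * u.2
  | inr true => - u.2
  | inr false => s * u.2 - c u.1 end.
have [|||l l_ge0 tE] := @farkas R (V * R^o)%type _ a (fun u => u.2).
- by move=> [i|[]] t [v r] [w r'];
    rewrite /a /= -[t *: r + r']/(t * (r : R) + r' : R) ?fP ?cP; ring.
- by move=> t u w.
- move=> [v t] H /=; rewrite leNgt; apply/negP => t0.
  have : P' (t^-1 *: v).
    move=> i; rewrite scalarZ // mulrC ler_pdivrMr //.
    by have := H (inl i); rewrite /a /= subr_le0.
  move/lt_s; rewrite scalarZ // mulrC ltr_pdivrMr // ltNge.
  by have := H (inr false); rewrite /a /= subr_le0 => ->.
pose mu := l (inr false).
have key v : P' v -> 1 <= mu * (s - c v).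
  move=> Pv; have /= := tE (v, 1); rewrite big_sumType big_bool /= => {1}->.
  rewrite /a /= !mulr1 -/mu.
  have : \sum_i l (inl i) * (f i v - q i) <= 0.
    by apply: sumr_le0 => i _; rewrite mulr_ge0_le0 // subr_le0; exact: Pv.
  rewrite (eq_bigr (fun i => l (inl i) * (f i v - q i * 1))); last first.
    by move=> i _; rewrite mulr1.
  have := l_ge0 (inr true); lra.
have mu_gt0 : 0 < mu.
  rewrite lt_neqAle l_ge0 andbT; apply/eqP => mu0.
  by have := key _ Pv0; rewrite -mu0 mul0r ler10.
suff : s <= s - mu^-1 by have := invr_gt0 mu; rewrite mu_gt0; lra.
apply: ge_sup => [|_ [v Pv <-]]; first by exists (c v0), v0.
have := key v Pv; rewrite -ler_pdivrMl // mulr1; lra.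
Qed.

Variables (I : eqType) (c : I -> V -> R).

(** Later objectives are compared only on the face where the earlier ones are maximal; that [v] lies
    in [P] is stated separately. *)
Fixpoint lexmax P (s : seq I) v : Prop :=
  if s is i :: s then
    (forall w, P w -> c i w <= c i v) /\
    lexmax (P `&` [set w | c i v <= c i w]) s v
  else True.

Lemma lexmax_exists P (s : seq I) :
  (forall i, scalar (c i)) -> polyhedral P -> P !=set0 ->
  (forall i, i \in s -> exists M, forall v, P v -> c i v <= M) ->
  exists2 v, P v & lexmax P s v.
Proof.
move=> cP; elim: s P => [|i s IH] P polP [v0 Pv0] bnd; first by exists v0.
have [M iM] := bnd i (mem_head _ _).
have [v1 Pv1 v1max] := polyhedral_max (cP i) polP (ex_intro _ v0 Pv0) iM.
have [|||v [Pv iv] vmax] := IH (P `&` [set w | c i v1 <= c i w]).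
- exact: polyhedral_ge.
- by exists v1; split => /=.
- move=> j js; have [|N jN] := bnd j; first by rewrite inE js orbT.
  by exists N => w [Pw _]; exact: jN.
have E : c i v1 = c i v by apply/le_anti; rewrite iv v1max.
by exists v => //=; split; rewrite -E.
Qed.

Lemma lexmax_cat P s1 s2 v : lexmax P (s1 ++ s2) v -> lexmax P s1 v.
Proof. by elim: s1 P => //= i s1 IH P [? /IH]. Qed.

Lemma lexmax_pareto P s v w : lexmax P s v -> P w ->
  (forall i, i \in s -> c i v <= c i w) -> forall i, i \in s -> c i w = c i v.
Proof.
elim: s P => //= j s IH P [jmax smax] Pw le_vw i.
have jw : c j v <= c j w by apply: le_vw; rewrite mem_head.
rewrite inE => /orP[/eqP ->|]; first by apply/le_anti; rewrite jw jmax.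
by apply: (IH _ smax) => // i' is'; apply: le_vw; rewrite inE is' orbT.
Qed.

(** At each objective both differences are nonpositive and a positive combination of them vanishes,
    so both are zero. This serves extremality as well as opposite moves from [v]. *)
Lemma lexmax_face P s v w1 w2 a1 a2 :
  lexmax P s v -> P w1 -> P w2 -> 0 < a1 -> 0 < a2 ->
  (forall i, i \in s -> a1 * (c i w1 - c i v) + a2 * (c i w2 - c i v) = 0) ->
  forall i, i \in s -> c i w1 = c i v /\ c i w2 = c i v.
Proof.
move=> + + + a1_gt0 a2_gt0; elim: s P => //= j s IH P [jmax smax] P1 P2 H i.
have [j1 j2] : c j w1 = c j v /\ c j w2 = c j v.
  have := H j (mem_head _ _); have := jmax _ P1; have := jmax _ P2.
  rewrite -subr_le0 => le2; rewrite -subr_le0 => le1 eq0.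
  by split; apply/eqP; rewrite -subr_eq0; apply/eqP; nra.
rewrite inE => /orP[/eqP -> //|]; apply: (IH _ smax) => [||i' is'].
- by split=> //=; rewrite j1.
- by split=> //=; rewrite j2.
by apply: H; rewrite inE is' orbT.
Qed.

End LexMax.

(** * Bases inside a set, and functionals vanishing on a subspace *)

Section Span.
Variables (R : realType) (V : vectType R).

(** Take a free family in [S] of maximal size: a vector of [S] outside its span would extend it. *)
Lemma span_set (S : set V) : exists s : seq V,
  [/\ free s, forall v, v \in s -> S v & forall v, S v -> v \in << s >>%VS].
Proof.
pose good k := `[< exists s : seq V,
  [/\ free s, forall v, v \in s -> S v & size s = k] >].
have good0 : exists k, good k by exists 0%N; apply/asboolP; exists [::]; rewrite nil_free.
have goodB k : good k -> (k <= \dim {:V})%N.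
  move=> /asboolP[s [free_s _ <-]].
  by rewrite -(eqP (free_s : \dim << s >> == size s)) dimvS // subvf.
case: (ex_maxnP good0 goodB) => k /asboolP[s [free_s sS sk]] kmax.
exists s; split=> // v Sv; apply: contrapT => /negP vs.
have /kmax : good k.+1.
  apply/asboolP; exists (v :: s); rewrite free_cons vs free_s /= sk.
  by split=> // w; rewrite inE => /orP[/eqP ->|/sS].
by rewrite ltnn.
Qed.

(** Some coordinate of the residue [v - projV U v] is nonzero, and this residue vanishes on [U]. *)
Lemma separating_functional (U : {vspace V}) (v : V) : v \notin U ->
  exists p : V -> R, [/\ scalar p, forall u, u \in U -> p u = 0 & p v <> 0].
Proof.
move=> vU; pose q u := u - projv U u.
pose p i u := coord (vbasis {:V}) i (q u).
have [i pi] : exists i, p i v <> 0.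
  apply: contrapT => /forallNP p0; move: vU.
  suff -> : v = projv U v by rewrite memv_proj.
  apply/eqP; rewrite -subr_eq0 -/(q v) (coord_vbasis (memvf (q v))) big1 // => i _.
  by have /contrapT := p0 i; rewrite /p => ->; rewrite scale0r.
exists (p i); split=> //.
  by move=> a u w; rewrite /p /q linearP opprD addrACA -scalerBr linearP.
by move=> u uU; rewrite /p /q projv_id // subrr linear0.
Qed.

End Span.

(** * Affine hulls *)

Section AffineHull.
Variables (R : realType) (V : vectType R).

Lemma affine_hull_sub (C : set V) : C `<=` affine_hull C.
Proof.
move=> u Cu; exists 1%N, (fun=> u), (fun=> 1); split=> //.
  by rewrite big_ord1.
by rewrite big_ord1 scale1r.
Qed.

(** Here [z] has weight [1 - s]; replacing it by its own affine combination keeps the total weight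
    1. *)
Lemma affine_hull_shift (C : set V) z k (t : 'I_k -> V) (a : 'I_k -> R) :
  affine_hull C z -> (forall i, C (t i)) ->
  affine_hull C (z + \sum_i a i *: (t i - z)).
Proof.
move=> [l [e [c [eC c1 zE]]]] tC; pose s := \sum_i a i.
have splitl j : fintype.split (lshift k j) = inl j := @unsplitK _ _ (inl j).
have splitr j : fintype.split (rshift l j) = inr j := @unsplitK _ _ (inr j).
exists (l + k)%N, (fun i => match fintype.split i with inl j => e j | inr j => t j end),
  (fun i => match fintype.split i with inl j => (1 - s) * c j | inr j => a j end).
split.
- by move=> i; case: (fintype.split i).
- rewrite big_split_ord /= (eq_bigr (fun j => (1 - s) * c j)); last first.
    by move=> j _; rewrite splitl.
  rewrite -mulr_sumr c1 mulr1 (eq_bigr a) ?subrK // => j _.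
  by rewrite splitr.
under eq_bigr do rewrite scalerBr.
rewrite sumrB -scaler_suml -/s addrCA -[X in X - _]scale1r -scalerBl addrC.
rewrite {1}zE scaler_sumr big_split_ord /=.
by congr (_ + _); apply: eq_bigr => j _; rewrite ?splitl ?splitr ?scalerA.
Qed.

End AffineHull.

Lemma dotp_continuous (R : realType) (n : nat) (p : 'cV[R]_n * R) :
  continuous (dotp p).
Proof.
have -> : dotp p =
    (fun u : 'cV[R]_n * R => \sum_i p.1^T 0 i * u.1 i 0) \+ (fun u => p.2 * u.2).
  by apply/funext => u; rewrite /dotp mxE.
move=> u; apply: cvgD; last by apply: cvgMl_tmp; exact: cvg_snd.
apply: cvg_big => [|i _]; first exact: add_continuous.
apply: cvgMl_tmp.
apply: (@cvg_comp _ _ _ fst (fun M : 'cV[R]_n => M i 0) _ (nbhs u.1)).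
  exact: cvg_fst.
exact: coord_continuous.
Qed.

(** * Multipliers, cut normals and the homogenized epigraph *)

Section Cut.
Variables (R : realType) (m n k : nat) (H : 'M[R]_(m, n)) (A : 'M[R]_(m, k)).
Variables (b : 'cV[R]_m) (d : 'cV[R]_k) (xs : 'cV[R]_n) (etas : R).
Implicit Types (g h : 'cV[R]_m * R) (w : 'cV[R]_n * R) (y : 'cV[R]_k) (t : R).

Local Notation z := (xs, etas).
Local Notation epi := (epi_z H A b d).
Local Notation P := (relaxed_alt_polyhedron H A b d xs etas).

(** One index set for [gamma] and [gamma0] pairs each entry with the constraint it weights. *)
Definition multiplier g (i : 'I_m + unit) : R :=
  match i with inl i => g.1 i 0 | inr _ => g.2 end.

Definition of_multiplier (l : 'I_m + unit -> R) : 'cV[R]_m * R :=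
  (\col_i l (inl i), l (inr tt)).

Definition normal g : 'cV[R]_n * R := (H^T *m g.1, - g.2).

(** For [g] in [P], this is the bound that the cut normal satisfies on [epi - z]. *)
Definition level g : R := (g.1^T *m (b - H *m xs)) 0 0 + g.2 * etas.

Definition combination g : 'rV[R]_k := g.1^T *m A + g.2 *: d^T.

(* The constraints of the epigraph, homogenized around [(xs, etas)]: for
   [t = 1] they say that [y] certifies [(xs, etas) + w \in epi]. *)
Definition constraint (i : 'I_m + unit) (u : ('cV[R]_n * R) * ('cV[R]_k * R^o)) : R :=
  match i with
  | inl i => (A *m u.2.1 + H *m u.1.1 - (u.2.2 : R) *: (b - H *m xs)) i 0
  | inr _ => (d^T *m u.2.1) 0 0 - u.1.2 - u.2.2 * etas
  end.

Lemma mxD p q (M N : 'M[R]_(p, q)) i j : (M + N) i j = M i j + N i j.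
Proof. by rewrite mxE. Qed.

Lemma mxZ p q a (M : 'M[R]_(p, q)) i j : (a *: M) i j = a * M i j.
Proof. by rewrite mxE. Qed.

Lemma mxB p q (M N : 'M[R]_(p, q)) i j : (M - N) i j = M i j - N i j.
Proof. by rewrite !mxE. Qed.

Lemma of_multiplierK l i : multiplier (of_multiplier l) i = l i.
Proof. by case: i => [i|[]] //=; rewrite mxE. Qed.

Lemma multiplier_scalar i : scalar (multiplier^~ i).
Proof. by case: i => [i|[]] a g h //=; rewrite !mxE. Qed.

Lemma multiplier_inj g h : (forall i, multiplier g i = multiplier h i) -> g = h.
Proof.
case: g h => [g g0] [h h0] E; congr pair; last exact: (E (inr tt)).
by apply/colP => i; exact: (E (inl i)).
Qed.

Lemma level_scalar : scalar level.
Proof.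
move=> a g h; rewrite /level /= linearP mulmxDl -scalemxAl mxD mxZ.
by rewrite -[a *: g.2 + h.2]/(a * g.2 + h.2); ring.
Qed.

Lemma combinationP : linear combination.
Proof.
move=> a g h; rewrite /combination /= linearP mulmxDl -scalemxAl.
by rewrite -[a *: g.2 + h.2]/(a * g.2 + h.2) scalerDl -scalerA scalerDr addrACA.
Qed.

Lemma dotp_scalar w : scalar (dotp w).
Proof.
move=> a u v; rewrite /dotp /= mulmxDr -scalemxAr mxD mxZ.
by rewrite -[a *: u.2 + v.2]/(a * u.2 + v.2); ring.
Qed.

Lemma normal_scalar w : scalar (fun g => dotp (normal g) w).
Proof.
move=> a g h; rewrite /dotp /normal /= mulmxDr -scalemxAr linearP mulmxDl.
rewrite -scalemxAl mxD mxZ -[a *: g.2 + h.2]/(a * g.2 + h.2); ring.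
Qed.

Lemma constraint_scalar i : scalar (constraint i).
Proof.
case: i => [i|[]] a [[w w0] [y t]] [[w' w0'] [y' t']]; rewrite /constraint /=.
  rewrite -[a *: t + t']/(a * (t : R) + t' : R) !mulmxDr -!scalemxAr.
  by rewrite !(mxB, mxD, mxZ); ring.
rewrite -[a *: t + t']/(a * (t : R) + t' : R).
rewrite -[a *: w0 + w0']/(a * w0 + w0') !mulmxDr -!scalemxAr.
by rewrite !(mxB, mxD, mxZ); ring.
Qed.

(** Sorts a weighted sum of constraints by [y], [w] and [t]; comparing coefficients reads off the
    Farkas certificates below. *)
Lemma sum_constraint g w y t :
  \sum_i multiplier g i * constraint i (w, (y, t)) =
  (combination g *m y) 0 0 + dotp (normal g) w - t * level g.
Proof.
rewrite big_sumType /= (big_pred1 tt) //=.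
pose X := A *m y + H *m w.1 - t *: (b - H *m xs).
rewrite -/X; have -> : \sum_i g.1 i 0 * X i 0 = (g.1^T *m X) 0 0.
  by rewrite [RHS]mxE; apply: eq_bigr => i _; rewrite [g.1^T _ _]mxE.
rewrite /X /combination /dotp /level /normal /= mulmxBr mulmxDr mulmxDl.
rewrite -scalemxAl -scalemxAr trmx_mul trmxK !mulmxA.
by rewrite !(mxB, mxD, mxZ); ring.
Qed.

Lemma objectiveE (w : 'cV[R]_n * R) g :
  dotp (H *m w.1, - w.2) g = dotp (normal g) w.
Proof.
have tr00 (M : 'M[R]_1) : M 0 0 = M^T 0 0 by rewrite mxE.
rewrite /dotp /normal /= tr00 !trmx_mul !trmxK mulmxA; ring.
Qed.

Lemma altP g : P g <->
  [/\ forall i, 0 <= multiplier g i, combination g = 0 & level g <= -1].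
Proof.
split=> [[g1 g2 gA gl]|[g0 gA gl]]; split=> //.
- by case.
- by move=> i; exact: (g0 (inl i)).
- exact: (g0 (inr tt)).
Qed.

(** * Duality between the epigraph and the alternative polyhedron *)

Lemma epiP u : epi u <-> exists y, forall i, constraint i (u - z, (y, 1)) <= 0.
Proof.
have E1 y i : constraint (inl i) (u - z, (y, 1)) = (A *m y) i 0 - (b - H *m u.1) i 0.
  by rewrite /= scale1r mulmxBr !(mxB, mxD); ring.
have E2 y : constraint (inr tt) (u - z, (y, 1)) = (d^T *m y) 0 0 - u.2.
  by rewrite /= mul1r; ring.
split=> [[y [y1 y2]]|[y Hy]]; exists y.
  by case=> [i|[]]; rewrite ?E1 ?E2 subr_le0.
by split=> [i|]; rewrite -subr_le0 -?E1 -?E2.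
Qed.

(** Weak duality: nonnegative weights times the nonpositive constraints of a certificate [y] sum to
    at most 0. *)
Lemma dotp_le_level g u : P g -> epi u -> dotp (normal g) (u - z) <= level g.
Proof.
move=> /altP[g0 gA _] /epiP[y Hy]; have := sum_constraint g (u - z) y 1.
rewrite gA mul0mx mxE add0r mul1r => /eqP; rewrite eq_sym subr_eq => /eqP ->.
by rewrite gerDr sumr_le0 // => i _; rewrite mulr_ge0_le0.
Qed.

Lemma cone_epi w y t : (forall i, constraint i (w, (y, t)) <= 0) -> 0 < t ->
  epi (z + t^-1 *: w).
Proof.
move=> Hw t_gt0; apply/epiP; exists (t^-1 *: y) => i; rewrite addrC addKr.
have -> : (t^-1 *: w, (t^-1 *: y, 1)) = t^-1 *: (w, (y, t)) :> _ * (_ * R^o).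
  by congr (_, (_, _)); rewrite -[RHS]/(t^-1 * t) mulVf // gt_eqF.
by rewrite (scalarZ (constraint_scalar i)) mulr_ge0_le0 // invr_ge0 ltW.
Qed.

(** With [w = 0], a solution with [t > 0] would rescale to a certificate of [z]. So the constraints
    imply [t <= 0], and the Farkas weights have [combination] 0 and [level] -1. *)
Lemma alt_nonempty : ~ epi z -> P !=set0.
Proof.
move=> epiNz.
pose a i (u : 'cV[R]_k * R^o) := constraint i (0, u).
have [|||l l_ge0 tE] := @farkas R _ _ a (fun u => u.2).
- move=> i c u v; rewrite /a -(constraint_scalar i); congr constraint.
  by congr pair; rewrite /= scaler0 addr0.
- by move=> t u w.
- move=> [y t] Hy /=; rewrite leNgt; apply/negP => /(cone_epi Hy).
  by rewrite scaler0 addr0.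
have E y t : t = (combination (of_multiplier l) *m y) 0 0 - t * level (of_multiplier l).
  have := sum_constraint (of_multiplier l) 0 y t.
  rewrite (scalar0 (dotp_scalar _)) addr0 => <-; rewrite [LHS](tE (y, t)).
  by apply: eq_bigr => i _; rewrite of_multiplierK.
exists (of_multiplier l); apply/altP; split.
- by move=> i; rewrite of_multiplierK.
- apply/rowP => j; have := E (delta_mx j 0) 0.
  by rewrite mul0r subr0 -colE !mxE.
- by have := E 0 1; rewrite mulmx0 mxE mul1r; lra.
Qed.

Lemma alt_polyhedral : polyhedral P.
Proof.
pose f (i : ('I_m + unit) + ('I_k * bool + unit)) g := match i with
  | inl i => - multiplier g i
  | inr (inl (j, true)) => combination g 0 j
  | inr (inl (j, false)) => - combination g 0 j
  | inr (inr _) => level g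
  end.
exists _, f, (fun i => if i is inr (inr _) then -1 else 0); split.
  move=> [i|[[j []]|i]] /=.
  - exact/scalar_opp/multiplier_scalar.
  - by move=> c g h /=; rewrite combinationP mxD mxZ.
  - by apply: scalar_opp => c g h /=; rewrite combinationP mxD mxZ.
  - exact: level_scalar.
apply/seteqP; split=> [g /altP[g0 gA gl] [i|[[j []]|i]]|g /= Hg] /=.
- by rewrite oppr_le0.
- by rewrite gA mxE.
- by rewrite gA mxE oppr0.
- exact: gl.
apply/altP; split.
- by move=> i; rewrite -oppr_le0; exact: (Hg (inl i)).
- apply/rowP => j; rewrite [RHS]mxE; apply/le_anti/andP; split.
    exact: (Hg (inr (inl (j, true)))).
  by rewrite -oppr_le0; exact: (Hg (inr (inl (j, false)))).
- exact: (Hg (inr (inr tt))).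
Qed.

(* Farkas for the cone of directions along which the constraints active at [g]
   stay tight: its valid inequalities are the derivatives of moves within [P]. *)
Lemma perturbation g (p : 'cV[R]_n * R -> R) (kappa : R) :
  (forall i, 0 <= multiplier g i) -> combination g = 0 -> scalar p ->
  (forall w y t, (forall i, constraint i (w, (y, t)) <= 0) -> 0 <= t ->
     0 <= \sum_i multiplier g i * constraint i (w, (y, t)) ->
     p w + kappa * t <= 0) ->
  exists g' e, [/\ 0 < e, forall i, 0 <= multiplier g' i, combination g' = 0,
    forall w, dotp (normal g') w = dotp (normal g) w + e * p w &
    level g' <= level g - e * kappa].
Proof.
move=> g0 gA pP Hp.
pose act u := \sum_i multiplier g i * constraint i u.
have actP : scalar act.
  move=> c u v; rewrite /act mulr_sumr -big_split; apply: eq_bigr => i _ /=.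
  by rewrite (constraint_scalar i); ring.
(* Once all constraints are nonpositive, [act >= 0] forces those with positive multiplier to be
   tight. *)
pose a (i : ('I_m + unit) + bool) u := match i with
  | inl i => constraint i u
  | inr true => - u.2.2
  | inr false => - act u
  end.
have [|||l l_ge0 cE] := @farkas R _ _ a (fun u => p u.1 + kappa * u.2.2).
- move=> [i|[]]; first exact: constraint_scalar.
    by apply: scalar_opp => c u v.
  exact: scalar_opp.
- move=> c [u [y t]] [v [y' t']] /=.
  by rewrite pP -[c *: t + t']/(c * (t : R) + t' : R); ring.
- move=> [w [y t]] Hw; apply: (Hp w y t).
  + by move=> i; exact: (Hw (inl i)).
  + by rewrite -oppr_le0; exact: (Hw (inr true)).
  + by rewrite -oppr_le0; exact: (Hw (inr false)).
pose h := of_multiplier (fun i => l (inl i)).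
pose mu := l (inr false); pose nu := l (inr true).
have E w y t : p w + kappa * t = (combination h *m y) 0 0 + dotp (normal h) w
    - t * level h - nu * t - mu * (dotp (normal g) w - t * level g).
  have := sum_constraint g w y t; rewrite gA mul0mx mxE add0r => <-.
  rewrite [LHS](cE (w, (y, t))) big_sumType big_bool /=.
  rewrite -sum_constraint /mu /nu /act.
  rewrite (eq_bigr (fun i => multiplier h i * constraint i (w, (y, t)))) //=.
    by ring.
  by move=> i _; rewrite of_multiplierK.
have n0 v : dotp (normal v) 0 = 0 := scalar0 (dotp_scalar _).
have hA : combination h = 0.
  apply/rowP => j; have := E 0 (delta_mx j 0) 0.
  by rewrite (scalar0 pP) !n0 -colE !mxE; lra.
have Ep w : dotp (normal h) w = p w + mu * dotp (normal g) w.
  by have := E w 0 0; rewrite mulmx0 mxE; lra.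
have El : level h = - kappa - nu + mu * level g.
  by have := E 0 0 1; rewrite mulmx0 mxE (scalar0 pP) !n0; lra.
have mu1 : 0 < 1 + mu by rewrite ltr_wpDr ?ltr01 //; exact: l_ge0.
(* The normal of [h] is [p] plus [mu] times that of [g], so dividing [g + h] by [1 + mu] moves the
   normal of [g] by [e] times [p]. *)
pose e := (1 + mu)^-1.
have e_gt0 : 0 < e by rewrite invr_gt0.
have e_mu x : e * (mu * x) = x - e * x.
  by rewrite /e; field; rewrite gt_eqF.
exists (e *: (g + h)), e; split=> //.
- move=> i; rewrite (scalarZ (multiplier_scalar i)) (scalarD (multiplier_scalar i)).
  by rewrite of_multiplierK mulr_ge0 ?addr_ge0 // ltW.
- rewrite -[e *: _]addr0 combinationP -[g]scale1r combinationP gA hA.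
  rewrite scaler0 addr0 scaler0 add0r.
  by rewrite /combination /= trmx0 mul0mx scale0r addr0.
- move=> w; rewrite (scalarZ (normal_scalar w)) (scalarD (normal_scalar w)) Ep.
  by move: (dotp _ w) (p w) => D q; rewrite !mulrDr e_mu; ring.
- rewrite (scalarZ level_scalar) (scalarD level_scalar) El.
  move: (level g) => D; rewrite !mulrDr e_mu.
  have : 0 <= e * nu by apply: mulr_ge0; [exact: ltW|exact: l_ge0].
  lra.
Qed.

(** * Separation and the facet criterion *)

Lemma dotp_closure_le0 (p : 'cV[R]_n * R) (S : set ('cV[R]_n * R)) w :
  (forall u, S u -> dotp p u <= 0) -> closure (conic_hull S) w -> dotp p w <= 0.
Proof.
move=> pS; have cl : closed [set u | dotp p u <= 0].
  apply: (@preimage_closed _ _ (dotp p) [set x | x <= 0]); last exact: closed_le.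
  by move=> u _; exact: dotp_continuous.
suff sub : conic_hull S `<=` [set u | dotp p u <= 0].
  by move=> /(closure_subset sub); rewrite -(closure_id _).1.
move=> _ [l [c [a [cS a0 ->]]]] /=; rewrite (scalar_sum (dotp_scalar p)).
by apply: sumr_le0 => i _; rewrite mulr_ge0_le0 // pS.
Qed.

Lemma separating_normal g : P g ->
  separating epi z (normal g) (dotp (normal g) z + level g).
Proof.
move=> Pg; split=> [u eu|] /=; rewrite /halfspace /=.
  have := dotp_le_level Pg eu.
  by rewrite (scalarB (dotp_scalar _)) lerBlDl.
by have /altP[_ _] := Pg; lra.
Qed.

Lemma normal_neq0 g : epi !=set0 -> P g -> normal g <> 0.
Proof.
move=> [u eu] Pg g0; have := dotp_le_level Pg eu; have /altP[_ _] := Pg.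
have -> : dotp (normal g) (u - z) = 0.
  by rewrite g0 /dotp /= trmx0 mul0mx mxE mul0r addr0.
lra.
Qed.

(** If [z] is in the affine hull of [epi], that hull is [z + << X >>] and the points [z + x i] are
    tight and affinely independent. Otherwise each [u - z] has coefficients of sum 1 in [X], which
    puts [u] on the hyperplane. *)
Lemma tight_spanning_facet g (X : seq ('cV[R]_n * R)) :
  epi !=set0 -> P g -> free X ->
  (forall v, v \in X -> epi (z + v) /\ dotp (normal g) v = level g) ->
  (forall u, epi u -> u - z \in << X >>%VS) ->
  facet_criterion H A b d (normal g).
Proof.
move=> epi0 Pg freeX XT Xspan; split; first exact: normal_neq0.
exists (dotp (normal g) z + level g).
pose x (i : 'I_(size X)) := X`_i.
have xX i : x i \in X by rewrite mem_nth.
have shift c q : affine_hull epi q ->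
    affine_hull epi (q + \sum_i c i *: (z + x i - q)).
  by move=> hq; apply: affine_hull_shift => // i; have [] := XT _ (xX i).
have decomp v : v \in << X >>%VS -> exists c, v = \sum_i c i *: x i.
  move=> vX; exists (fun i => coord (in_tuple X) i v).
  exact: (@coord_span _ _ _ (in_tuple X)).
have [hz|nhz] := pselect (affine_hull epi z).
  left; split; first by have [] := separating_normal Pg.
  exists (size X); split.
    exists z, << X >>%VS; split; last exact/eqP.
    apply/seteqP; split=> [u [l [e [c [eC c1 ->]]]]|_ [w wX <-]].
      exists (\sum_i c i *: (e i - z)); last first.
        under eq_bigr do rewrite scalerBr.
        by rewrite sumrB -scaler_suml c1 scale1r addrC subrK.
      by apply: memv_suml => i _; apply: memvZ; apply: Xspan.
    have [c ->] := decomp w wX.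
    have := shift c z hz; congr (affine_hull _ (_ + _)).
    by apply: eq_bigr => i _; rewrite addrAC subrr add0r.
  exists (fun i => z + x i); split; last first.
    move=> i; have [ei li] := XT _ (xX i); split=> //.
    by rewrite /hyperplane /= (scalarD (dotp_scalar _)) li.
  move=> c c0 cx; have /freeP := freeX : free (in_tuple X); apply.
  move: cx; under eq_bigr do rewrite scalerDr.
  by rewrite big_split /= -scaler_suml c0 scale0r add0r.
right=> u eu; have [c uE] := decomp _ (Xspan u eu).
have c1 : \sum_i c i = 1.
  apply: contrapT => /eqP; set s := \sum_i c i; rewrite eq_sym -subr_eq0 => s1.
  (* For [s] other than 1, these coefficients write [z] as an affine combination of [u] and the
     tight points. *)
  apply: nhz; have := shift (fun i => - (1 - s)^-1 * c i) u (affine_hull_sub eu).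
  congr (affine_hull _ _).
  under eq_bigr => i _ do rewrite -scalerA [z + _]addrC -addrA -[z - u]opprB scalerBr.
  rewrite -scaler_sumr sumrB -uE -scaler_suml -/s.
  have -> : u - z - s *: (u - z) = (1 - s) *: (u - z) by rewrite scalerBl scale1r.
  by rewrite scaleNr scalerA mulVf // scale1r opprB addrC subrK.
rewrite /hyperplane /= -[u in LHS](subrK z) addrC (scalarD (dotp_scalar _)) uE.
congr (_ + _); rewrite (scalar_sum (dotp_scalar _)).
under eq_bigr => i _ do rewrite (XT _ (xX i)).2.
by rewrite -mulr_suml c1 mul1r.
Qed.

(** * The lexicographic optimum and its tight face *)

Lemma exists_optimal_vertex w0 : epi !=set0 -> ~ epi z ->
  closure (conic_hull [set u - z | u in epi]) w0 ->
  exists g, [/\ extreme_point P g,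
    forall g', P g' -> dotp (normal g') w0 <= dotp (normal g) w0 &
    facet_criterion H A b d (normal g)].
Proof.
move=> [e0 epie0] epiNz w0cl.
have [Y [_ YS Yspan]] := span_set [set u - z | u in epi].
(* [w0] comes first for optimality; [e0 - z] is at most -1 on [P], so shrinking the normal strictly
   improves it; [Y] spans all of [epi - z]. *)
pose ws := [:: w0, e0 - z & Y].
pose c (i : ('cV[R]_n * R) + ('I_m + unit)) g : R :=
  match i with inl w => dotp (normal g) w | inr j => - multiplier g j end.
pose sw : seq (('cV[R]_n * R) + ('I_m + unit)) := map inl ws.
pose sj : seq (('cV[R]_n * R) + ('I_m + unit)) := map inr (index_enum ('I_m + unit)%type).
have cP i : scalar (c i).
  case: i => [w|j]; first exact: normal_scalar.
  exact/scalar_opp/multiplier_scalar.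
have epi_le w g : [set u - z | u in epi] w -> P g -> dotp (normal g) w <= -1.
  move=> [u eu <-] Pg; apply: (le_trans (dotp_le_level Pg eu)).
  by have /altP[] := Pg.
have ws_le w g : w \in ws -> P g -> dotp (normal g) w <= 0.
  rewrite !inE => + Pg; case/or3P => [/eqP ->|/eqP ->|/YS wS].
  - apply: dotp_closure_le0 w0cl => u uS.
    by apply: (le_trans (epi_le _ _ uS Pg)); rewrite lerN10.
  - by apply: (le_trans (epi_le (e0 - z) _ _ Pg)); [exists e0|rewrite lerN10].
  - by apply: (le_trans (epi_le _ _ wS Pg)); rewrite lerN10.
have [|g Pg gmax] := @lexmax_exists _ _ _ c P (sw ++ sj) cP alt_polyhedral
  (alt_nonempty epiNz).
  move=> i; rewrite mem_cat => /orP[/mapP[w w_ws ->]|/mapP[j _ ->]]; exists 0 => h Ph.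
    exact: ws_le.
  by rewrite /= oppr_le0; have /altP[] := Ph.
(* The moves below control only the normals, so the coordinate objectives are dropped. *)
have gmaxw := lexmax_cat gmax.
have [g0 gA gl] := (altP g).1 Pg.
exists g; split.
- split=> // u w t Pu Pw /andP[t0 t1] gE.
  (* The coordinates are among the objectives, so [lexmax_face] makes them agree in [u], [w] and
     [g]. *)
  suff E j : multiplier u j = multiplier g j /\ multiplier w j = multiplier g j.
    by apply: multiplier_inj => j; have [-> ->] := E j.
  have t1' : 0 < 1 - t by rewrite subr_gt0.
  have : inr j \in sw ++ sj.
    by rewrite mem_cat; apply/orP; right; apply: map_f; exact: mem_index_enum.
  case/(lexmax_face gmax Pu Pw t0 t1') => [i _|/oppr_inj -> /oppr_inj ->//].
  by rewrite gE (scalarD (cP i)) !(scalarZ (cP i)); ring.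
- by move=> h Ph; case: gmax => /(_ h Ph).
have mem_ws w : w \in ws -> inl w \in sw by exact: map_f.
have [X [freeX XT Xspan]] :=
  span_set [set v | epi (z + v) /\ dotp (normal g) v = level g].
apply: (@tight_spanning_facet g X) => //; first by exists e0.
(* Homogenized tight face: [t > 0] gives multiples of tight points minus [z], [t = 0] recession
   directions. *)
pose tight w y t := [/\ forall i, constraint i (w, (y, t)) <= 0, 0 <= t &
  0 <= \sum_i multiplier g i * constraint i (w, (y, t))].
have tightD w y t w' y' t' : tight w y t -> tight w' y' t' ->
    tight (w + w') (y + y') (t + t').
  have E i : constraint i (w + w', (y + y', t + t')) =
      constraint i (w, (y, t)) + constraint i (w', (y', t')).
    by rewrite -(scalarD (constraint_scalar i)).
  move=> [H1 H2 H3] [H1' H2' H3']; split.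
  - by move=> i; rewrite E; have := H1 i; have := H1' i; lra.
  - exact: addr_ge0.
  by under eq_bigr do rewrite E mulrDr; rewrite big_split addr_ge0.
have tightX w y t : tight w y t -> 0 < t -> w \in << X >>%VS.
  move=> [H1 _ H3] t_gt0.
  have -> : w = t *: (t^-1 *: w) by rewrite scalerA mulfV ?scale1r // gt_eqF.
  apply/memvZ/Xspan; split; first exact: cone_epi H1 t_gt0.
  have : \sum_i multiplier g i * constraint i (w, (y, t)) = 0.
    apply/le_anti; rewrite H3 andbT; apply: sumr_le0 => i _.
    exact: mulr_ge0_le0.
  rewrite sum_constraint gA mul0mx mxE add0r => /eqP; rewrite subr_eq0 => /eqP E.
  by rewrite (scalarZ (dotp_scalar _)) E mulKf // gt_eqF.
(* Otherwise some [g'] in [P] has its normal a positive multiple of that of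
   [g] but shorter, so it improves the objective [e0 - z]. *)
have [w1 [y1 [t1 [tight1 t1_gt0]]]] : exists w y t, tight w y t /\ 0 < t.
  apply: contrapT => Ntight.
  have [|w y t H1 H2 H3|h [e [e_gt0 h0 hA hn hl]]] :=
      @perturbation g (fun=> 0) 1 g0 gA.
  - by move=> a u v; rewrite mulr0 addr0.
  - rewrite add0r mul1r leNgt; apply/negP => t_gt0.
    by apply: Ntight; exists w, y, t; split.
  (* Since [level h <= -1 - e], this factor keeps the level at most -1 while shrinking the
     normal. *)
  pose f := (1 + e)^-1.
  have e1 : 0 < 1 + e by rewrite addr_gt0.
  have Ph : P (f *: h).
    apply/altP; split.
    - move=> i; rewrite (scalarZ (multiplier_scalar i)) mulr_ge0 // invr_ge0.
      exact: ltW.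
    - by rewrite -[f *: h]addr0 combinationP hA scaler0 add0r /combination
        trmx0 mul0mx scale0r addr0.
    - rewrite (scalarZ level_scalar) /f ler_pdivrMl //; lra.
  have hE w : dotp (normal (f *: h)) w = f * dotp (normal g) w.
    by rewrite (scalarZ (normal_scalar w)) hn mulr0 addr0.
  have f1 : f < 1 by rewrite invf_lt1 // ltrDl.
  have le1 : dotp (normal g) (e0 - z) <= -1 by apply: epi_le => //; exists e0.
  have hmax : c (inl (e0 - z)) (f *: h) = c (inl (e0 - z)) g.
    apply: (lexmax_pareto gmaxw Ph) => [_ /mapP[w w_ws ->] /=|].
      by rewrite hE; have := ws_le w g w_ws Pg; nra.
    by apply: mem_ws; rewrite !inE eqxx orbT.
  by move: hmax; rewrite /= hE; nra.
(* For [t = 0], adding [w1] makes [t] positive; the sum and [w1] both lie in the span. *)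
have tight_span w y t : tight w y t -> w \in << X >>%VS.
  move=> T; have [_ t0 _] := T; rewrite -[w](addrK w1); apply: rpredB.
    by apply: (tightX _ (y + y1) (t + t1)); [exact: tightD|rewrite ltr_wpDl].
  exact: tightX tight1 t1_gt0.
move=> u eu; apply: contrapT => /negP /separating_functional[p [pP pX pu]].
apply: pu.
(* With [kappa = 0] the level does not grow, so the moves along [p] and [- p] both stay in [P]. *)
have [|g1 [e1 [e1_gt0 g1_0 g1A g1n g1l]]] := @perturbation g p 0 g0 gA pP.
  by move=> w y t ? ? ?; rewrite mul0r addr0 (pX w) //; apply: (tight_span _ y t).
have [|g2 [e2 [e2_gt0 g2_0 g2A g2n g2l]]] := @perturbation g _ 0 g0 gA (scalar_opp pP).
  by move=> w y t ? ? ?; rewrite mul0r addr0 (pX w) ?oppr0 //; apply: (tight_span _ y t).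
have P1 : P g1 by apply/altP; split=> //; move: g1l; rewrite mulr0; lra.
have P2 : P g2 by apply/altP; split=> //; move: g2l; rewrite mulr0; lra.
(* The weights [e2] and [e1] cancel the opposite moves, so [p] vanishes on [Y] and hence at [u - z],
   against its choice. *)
have pY v : v \in Y -> p v = 0.
  move=> vY; have : inl v \in sw by rewrite mem_ws // !inE vY !orbT.
  case/(lexmax_face gmaxw P1 P2 e2_gt0 e1_gt0) => [_ /mapP[w _ ->]|/=] /=.
    by rewrite g1n g2n; ring.
  move=> + _; rewrite g1n => /eqP.
  by rewrite -subr_eq0 addrAC subrr add0r mulf_eq0 gt_eqF //= => /eqP.
have uY : u - z \in << Y >>%VS by apply: Yspan; exists u.
rewrite (@coord_span _ _ _ (in_tuple Y) (u - z) uY) (scalar_sum pP) big1 // => i _.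
by rewrite pY ?mulr0 //; apply: mem_nth.
Qed.

End Cut.

Theorem theorem20 (R : realType) (m n k : nat) (H : 'M[R]_(m, n))
    (A : 'M[R]_(m, k)) (b : 'cV[R]_m) (d : 'cV[R]_k)
    (xs : 'cV[R]_n) (etas : R) (omega : 'cV[R]_n) (omega0 : R)
    (epi_neq0 : epi_z H A b d !=set0)
    (xs_notin : ~ epi_z H A b d (xs, etas))
    (omega_in : closure (conic_hull [set u - (xs, etas) | u in epi_z H A b d])
                  (omega, omega0)) :
  exists g : 'cV[R]_m * R,
    [/\ extreme_point (relaxed_alt_polyhedron H A b d xs etas) g,
        forall g', relaxed_alt_polyhedron H A b d xs etas g' ->
          dotp (H *m omega, - omega0) g' <= dotp (H *m omega, - omega0) g,
        exists alpha : R,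
          separating (epi_z H A b d) (xs, etas) (H^T *m g.1, - g.2) alpha &
        facet_criterion H A b d (H^T *m g.1, - g.2)].
Proof.
have [g [g_ext g_opt g_facet]] := exists_optimal_vertex epi_neq0 xs_notin omega_in.
exists g; split=> //.
  move=> g' Pg'; rewrite !(objectiveE H (omega, omega0)); exact: g_opt.
by eexists; apply: separating_normal; case: g_ext.
Qed.
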